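(* Let $L:\mathbb{R}^n\times\mathbb{R}^n\to\mathbb{R}$ be the Lagrangian associated with a Hamiltonian $H$ as in the context, and suppose there are positive constants $A,B$ with $A^{-1}|v|^2-B\le L(x,v)\le A|v|^2+B$ for all $(x,v)\in\mathbb{R}^n\times\mathbb{R}^n$, and that $L$ is continuously differentiable on $\mathbb{R}^n\times\mathbb{R}^n$. Let $x\in\mathbb{R}^n$ and let $\eta\in\mathcal{A}_x$ be a minimizer, i.e. $J[x,\eta]=u(x)$. Then there exists a constant $C_5>0$ depending only on $C_H,A,B$ such that $|\dot\eta(s)|\le C_5$ for a.e. $s\in(0,\infty)$.
   Context: Standing setting: $H:\mathbb{R}^n\times\mathbb{R}^n\to\mathbb{R}$ is continuous, bounded below ($H\ge -C_1$), $\sup_x|H(x,0)|\le C_2$, $p\mapsto H(x,p)$ is convex for each $x$, $\lim_{|p|\to\infty}\inf_x H(x,p)/|p|=+\infty$, and for every $R>0$ there is a nondecreasing $\omega_R:[0,\infty)\to[0,\infty)$ with $\omega_R(0^+)=0$ such that $|H(x,p)-H(y,p)|\le\omega_R(|x-y|)$ and $|H(x,p)-H(x,q)|\le\omega_R(|p-q|)$ for all $x,y$ and $|p|,|q|\le R$. The Lagrangian is $L(x,v)=\sup_{p\in\mathbb{R}^n}\{p\cdot v-H(x,p)\}$, which is continuous and convex in $v$. For $x\in\mathbb{R}^n$, $\mathcal{A}_x=\{\eta\in\mathrm{AC}([0,\infty);\mathbb{R}^n):\eta(0)=x\}$ (absolutely continuous curves), $J[x,\eta]=\int_0^\infty e^{-s}L(\eta(s),-\dot\eta(s))\,ds$,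 and $u(x)=\inf_{\eta\in\mathcal{A}_x}J[x,\eta]$. The function $u$ is bounded and Lipschitz, and $C_H>0$ denotes a constant, depending only on $H$, with $\|u\|_{L^\infty(\mathbb{R}^n)}+\|Du\|_{L^\infty(\mathbb{R}^n)}\le C_H$. *)

(* Defs.v *)
From HB Require Import structures.
From mathcomp Require Import all_boot all_order all_algebra.
From mathcomp Require Import all_classical all_reals all_analysis.

Set Implicit Arguments.
Unset Strict Implicit.
Unset Printing Implicit Defensive.
Import Order.TTheory GRing.Theory Num.Theory.
Import numFieldNormedType.Exports.
Local Open Scope classical_set_scope.
Local Open Scope ring_scope.

Definition dotv {R : realType} {n : nat} (p v : 'rV[R]_n) : R :=
  \sum_(i < n) p 0 i * v 0 i.

(* The norm `|v| of 'rV[R]_n is the sup norm, hence a separate definition for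
   the Euclidean one; both induce the same topology. *)
Definition enorm {R : realType} {n : nat} (v : 'rV[R]_n) : R :=
  Num.sqrt (dotv v v).

(* The values of omega on negative reals are irrelevant. *)
Definition hamiltonian {R : realType} {n : nat}
    (H : 'rV[R]_n -> 'rV[R]_n -> R) : Prop :=
  [/\ continuous (fun z : 'rV[R]_n * 'rV[R]_n => H z.1 z.2),
      (exists C1 : R, forall x p, - C1 <= H x p) /\
      (exists C2 : R, forall x, `|H x 0| <= C2),
      (forall x, convex_function setT (H x)),
      (forall M : R, exists r : R, forall p, r < enorm p ->
         M <= inf [set H x p / enorm p | x in [set: 'rV[R]_n]])
    & (forall r : R, 0 < r -> exists omega : R -> R,
         [/\ (forall s, 0 <= s -> 0 <= omega s),
             (forall s t, 0 <= s -> s <= t -> omega s <= omega t),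
             omega t @[t --> 0^'+] --> 0,
             (forall x y p, enorm p <= r ->
                `|H x p - H y p| <= omega (enorm (x - y)))
           & (forall x p q, enorm p <= r -> enorm q <= r ->
                `|H x p - H x q| <= omega (enorm (p - q)))])].

(* A real supremum: superlinear growth makes the set bounded above. *)
Definition lagrangian {R : realType} {n : nat} (H : 'rV[R]_n -> 'rV[R]_n -> R)
    (x v : 'rV[R]_n) : R :=
  sup [set dotv p v - H x p | p in [set: 'rV[R]_n]].

(* In finite dimension, continuity of the differential in operator norm is
   continuity of z |-> 'd f z w for every direction w. *)
Definition continuously_differentiable {R : realType} {V W : normedModType R}
    (f : V -> W) : Prop :=
  (forall z, differentiable f z) /\ (forall w, continuous (fun z => 'd f z w)).

(* The epsilon-delta definition on every [0, T]: AC([0,oo)) is understood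
   locally, as usual for infinite-horizon problems.  Only the restriction of
   eta to [0, +oo[ is constrained. *)
Definition AC_halfline {R : realType} {n : nat} (eta : R -> 'rV[R]_n) : Prop :=
  forall T e : R, 0 < T -> 0 < e ->
  exists2 d : R, 0 < d &
    forall (m : nat) (a b : 'I_m -> R),
      (forall k, [/\ 0 <= a k, a k <= b k & b k <= T]) ->
      trivIset setT (fun k => `]a k, b k[%classic) ->
      \sum_(k < m) (b k - a k) < d ->
      \sum_(k < m) enorm (eta (b k) - eta (a k)) < e.

Definition admissible {R : realType} {n : nat} (x : 'rV[R]_n) :
    set (R -> 'rV[R]_n) :=
  [set eta | AC_halfline eta /\ eta 0 = x].

(* derive1 eta is arbitrary where eta is not derivable; for an absolutely continuous
   eta this is a null set. *)
Definition cost {R : realType} {n : nat} (L : 'rV[R]_n -> 'rV[R]_n -> R)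
    (eta : R -> 'rV[R]_n) : \bar R :=
  \int[lebesgue_measure]_(s in `[0, +oo[%classic)
    (expR (- s) * L (eta s) (- derive1 eta s))%:E.

Definition value {R : realType} {n : nat} (L : 'rV[R]_n -> 'rV[R]_n -> R)
    (x : 'rV[R]_n) : \bar R :=
  ereal_inf [set cost L eta | eta in admissible x].

(* Null sets for the n-dimensional Lebesgue measure, n > 0 (for n = 0 every box
   has volume 1, and not even the empty set would be null). *)
Definition lebesgue_null {R : realType} {n : nat} (N : set 'rV[R]_n) : Prop :=
  forall e : R, 0 < e ->
  exists a b : nat -> 'rV[R]_n,
    [/\ (forall k i, a k 0 i <= b k 0 i),
        (N `<=` \bigcup_k [set x | forall i, a k 0 i <= x 0 i <= b k 0 i])
      & (\sum_(0 <= k <oo) (\prod_(i < n) (b k 0 i - a k 0 i))%:E <= e%:E)%E].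

(* Essential supremum as in the library's [ess_sup]; there is no Lebesgue measure
   on 'rV[R]_n to instantiate it with. *)
Definition ess_sup_rV {R : realType} {n : nat} (f : 'rV[R]_n -> \bar R) :
    \bar R :=
  ereal_inf [set y | lebesgue_null [set x | ~ (f x <= y)%E]].

Definition gradient {R : realType} {n : nat} (f : 'rV[R]_n -> R)
    (x : 'rV[R]_n) : 'rV[R]_n :=
  \row_(i < n) 'D_(delta_mx 0 i) f x.

(* ||u||_oo + ||Du||_oo.  The value function of a Hamiltonian satisfying
   [hamiltonian] is finite and Lipschitz, so Du exists almost everywhere. *)
Definition W1oo_norm {R : realType} {n : nat} (u : 'rV[R]_n -> \bar R) :
    \bar R :=
  (ess_sup_rV (fun x => `|u x|) +
   ess_sup_rV (fun x => (enorm (gradient (fine \o u) x))%:E))%E.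

(* Main.v *)
(** Use [e^-t (L + B) >= 0] as running cost.  For [0 < s] and small [h > 0] put
    [tau := |eta (s + h) - eta s|].  If [h <= tau], compare [eta] with the curve that
    follows [eta] up to time [s], reaches [eta (s + h)] at unit speed at time
    [s + tau], and then follows [eta] with the delay [tau - h].  The discount makes
    the delayed tail cheaper, and a unit-speed segment costs at most [A + 2 B] per
    unit of time, so minimality gives
    [\int_s^(s+h) e^-t (L (eta, - eta') + B) <= e^-s (A + 2 B) tau].
    Dividing by [h] and letting [h] tend to 0 yields, at almost every [s] with
    [|eta' s| > 1], the inequality [|eta' s|^2 / A <= (A + 2 B) |eta' s|].
    Where [eta] is not derivable, [derive1 eta] is 0, so no differentiability theorem
    for absolutely continuous curves is needed. *)
Require Import Defs.
From HB Require Import structures.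
From mathcomp Require Import all_boot all_order all_algebra.
From mathcomp Require Import all_classical all_reals all_analysis.
From mathcomp Require Import measurable_realfun ring lra.
Import Order.TTheory GRing.Theory Num.Theory.
Import numFieldNormedType.Exports.
Local Open Scope classical_set_scope.
Local Open Scope ring_scope.

(** * The Euclidean norm and its comparison with the sup norm *)

Section euclidean_norm.
Context {R : realType} {n : nat}.
Implicit Types v w : 'rV[R]_n.

Lemma dotvv_ge0 v : 0 <= dotv v v.
Proof. by apply: sumr_ge0 => i _; rewrite -expr2 sqr_ge0. Qed.

Lemma enorm_ge0 v : 0 <= enorm v.
Proof. exact: sqrtr_ge0. Qed.

Lemma sqr_enorm v : enorm v ^+ 2 = dotv v v.
Proof. by rewrite sqr_sqrtr ?dotvv_ge0. Qed.

Lemma enormZ (a : R) v : enorm (a *: v) = `|a| * enorm v.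
Proof.
rewrite /enorm -sqrtr_sqr -sqrtrM ?sqr_ge0//; congr Num.sqrt.
by rewrite /dotv mulr_sumr; apply: eq_bigr => i _; rewrite mxE mulrACA -expr2.
Qed.

Lemma enorm0 : enorm (0 : 'rV[R]_n) = 0.
Proof. by rewrite -(scale0r 0) enormZ normr0 mul0r. Qed.

Lemma enormN v : enorm (- v) = enorm v.
Proof. by rewrite -scaleN1r enormZ normrN1 mul1r. Qed.

(* Weaker than the triangle inequality, but free of Cauchy-Schwarz. *)
Lemma enormD_le v w : enorm (v + w) <= 2 * (enorm v + enorm w).
Proof.
have v0 := enorm_ge0 v; have w0 := enorm_ge0 w.
rewrite -(@ler_pXn2r _ 2) ?nnegrE ?enorm_ge0//; last by rewrite mulr_ge0 ?addr_ge0.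
have : enorm (v + w) ^+ 2 <= 2 * enorm v ^+ 2 + 2 * enorm w ^+ 2.
  rewrite !sqr_enorm /dotv !mulr_sumr -big_split/=; apply: ler_sum => i _.
  by rewrite mxE; have := sqr_ge0 (v 0 i - w 0 i); nra.
by move=> /le_trans; apply; nra.
Qed.

Lemma coord_le_enorm v i : `|v 0 i| <= enorm v.
Proof.
rewrite -sqrtr_sqr ler_wsqrtr// /dotv (bigD1 i)//= -expr2 lerDl.
by apply: sumr_ge0 => j _; rewrite -expr2 sqr_ge0.
Qed.

Lemma norm_le_enorm v : `|v| <= enorm v.
Proof.
rewrite [leLHS](mx_normrE v); apply: bigmax_le; first exact: enorm_ge0.
by move=> [i j] _ /=; rewrite ord1 coord_le_enorm.
Qed.

Lemma continuous_enorm : continuous (@enorm R n).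
Proof.
move=> v.
apply: (@continuous_comp _ _ _ (fun v : 'rV[R]_n => dotv v v) (@Num.sqrt R));
  last exact: sqrt_continuous.
move: v; apply: continuous_big => [|i _ v]; first exact: add_continuous.
by apply: continuousM; exact: coord_continuous.
Qed.

End euclidean_norm.

(** * Operations that preserve absolute continuity *)

Section absolutely_continuous_curves.
Context {R : realType} {n : nat}.
Implicit Types f g : R -> 'rV[R]_n.

Lemma AC_halflineD f g : AC_halfline f -> AC_halfline g -> AC_halfline (f \+ g).
Proof.
move=> acf acg T e T0 e0.
(* The factor 2 in [enormD_le] turns two sums below [e / 4] into a bound by [e]. *)
have e4 : 0 < e / 4 by lra.
have [d1 d10 fd] := acf T _ T0 e4; have [d2 d20 gd] := acg T _ T0 e4.
exists (Num.min d1 d2); first by rewrite lt_min d10.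
move=> m a b ab tI; rewrite lt_min => /andP[sd1 sd2].
have := fd _ _ _ ab tI sd1; have := gd _ _ _ ab tI sd2 => gs fs.
have : \sum_(k < m) enorm ((f \+ g) (b k) - (f \+ g) (a k)) <=
  \sum_(k < m) 2 * (enorm (f (b k) - f (a k)) + enorm (g (b k) - g (a k))).
  by apply: ler_sum => k _ /=; rewrite opprD addrACA enormD_le.
by rewrite -mulr_sumr big_split/=; lra.
Qed.

Lemma AC_halfline_lipschitz f :
  (forall s t, 0 <= s -> s <= t -> enorm (f t - f s) <= t - s) ->
  AC_halfline f.
Proof.
move=> lf T e T0 e0; exists e => // m a b ab _; apply: le_lt_trans.
by apply: ler_sum => k _; have [a0 abk _] := ab k; exact: lf.
Qed.

(** A nondecreasing 1-Lipschitz change of time maps disjoint intervals to disjoint intervals without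
    increasing their total length. Truncations of time and delays are of this kind. *)
Lemma AC_halfline_comp f (phi : R -> R) :
  (forall s, 0 <= s -> 0 <= phi s) ->
  (forall s t, 0 <= s -> s <= t -> phi s <= phi t) ->
  (forall s t, 0 <= s -> s <= t -> phi t - phi s <= t - s) ->
  AC_halfline f -> AC_halfline (f \o phi).
Proof.
(* The Lipschitz bound keeps [phi] below [phi 0 + T] on [[0, T]], which gives the horizon for
   [f]. *)
move=> phi0 phim phil acf T e T0 e0.
have [||d d0 fd] := acf (phi 0 + T) e; [|by []|].
  by have := phi0 0 (lexx 0); lra.
exists d => // m a b ab tI sd; apply: fd.
- move=> k; have [a0 abk bT] := ab k; split; [exact: phi0|exact: phim|].
  by have := phil 0 (b k) (lexx 0) (le_trans a0 abk); lra.
- move=> i j _ _ [z [/=]]; rewrite !in_itv/= => /andP[aiz zbi] /andP[ajz zbj].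
  have lt_ab k l : phi (a k) < phi (b l) -> a k < b l.
    rewrite !ltNge; apply: contra => ba; apply: phim => //.
    by have [a0 abl _] := ab l; exact: le_trans abl.
  apply: tI => //.
  (* If the image intervals meet, monotonicity makes the original ones overlap, and the midpoint of
     the overlap lies in both. *)
  exists ((Num.max (a i) (a j) + Num.min (b i) (b j)) / 2) => /=.
  have : Num.max (a i) (a j) < Num.min (b i) (b j).
    by rewrite gt_max !lt_min; apply/andP; split; apply/andP; split;
      apply: lt_ab; apply: lt_trans; eassumption.
  have : a i <= Num.max (a i) (a j) by rewrite le_max lexx.
  have : a j <= Num.max (a i) (a j) by rewrite le_max lexx orbT.
  have : Num.min (b i) (b j) <= b i by rewrite ge_min lexx.
  have : Num.min (b i) (b j) <= b j by rewrite ge_min lexx orbT.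
  by move=> *; split; rewrite in_itv/=; apply/andP; split; lra.
- apply: le_lt_trans sd; apply: ler_sum => k _.
  by have [a0 abk _] := ab k; exact: phil.
Qed.

(** Absolute continuity is applied to a single interval. Time is cut off at 0 because [f] is
    arbitrary on negative reals. *)
Lemma AC_halfline_continuous f : AC_halfline f ->
  continuous (fun t : R => f (Num.max t 0)).
Proof.
move=> acf t; apply/cvgrPdist_lt => e e0.
have T0 : 0 < `|t| + 1 by rewrite ltr_pwDr.
have [d d0 fd] := acf _ e T0 e0.
have {}fd a b : 0 <= a -> a <= b -> b <= `|t| + 1 -> b - a < d ->
    `|f b - f a| < e.
  move=> a0 ab bT bad; apply: le_lt_trans (norm_le_enorm _) _.
  have := fd 1%N (fun=> a) (fun=> b); rewrite !big_ord1; apply => //.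
  by move=> i j _ _ _; rewrite !ord1.
near=> s.
have : `|t - s| < Num.min d 1.
  by near: s; apply: cvgr_dist_lt => //; rewrite lt_min d0/=.
rewrite lt_min => /andP[tsd ts1].
have := ler_norm t; have := normr_ge0 t.
have := ler_norm (t - s); have := ler_norm (s - t); rewrite (distrC s) => *.
have [ts|ts] := leP (Num.max t 0) (Num.max s 0).
  rewrite distrC; apply: fd => //; first by rewrite le_max lexx orbT.
    by case: (leP s 0); lra.
  by move: ts; case: (leP s 0); case: (leP t 0); lra.
apply: fd; rewrite ?(ltW ts)//; first by rewrite le_max lexx orbT.
  by case: (leP t 0); lra.
by move: ts; case: (leP s 0); case: (leP t 0); lra.
Unshelve. all: by end_near. Qed.

End absolutely_continuous_curves.

(** * Translation of Lebesgue integrals *)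

Lemma lebesgue_measure_shift (R : realType) (c : R) (A : set R) : measurable A ->
  pushforward lebesgue_measure (fun x => x + c : measurableTypeR R) A =
  lebesgue_measure A.
Proof.
move=> mA; have mphi : measurable_fun setT (fun x : R => x + c) by exact: measurable_funD.
apply/esym/lebesgue_measure_unique => //= _ [[a b]] _ <-.
rewrite /pushforward (_ : _ @^-1` _ = `]a - c, b - c]%classic).
  by rewrite !lebesgue_measure_itv/= !lte_fin ltrD2r -!EFinD opprD opprK addrACA addNr addr0.
by apply/seteqP; split => x /=; rewrite !in_itv/= ltrBlDr lerBrDr.
Qed.

Lemma ge0_integral_shift (R : realType) (c r : R) (f : R -> \bar R) :
  measurable_fun `]r + c, +oo[%classic f ->
  (forall t, r + c < t -> (0 <= f t)%E) ->
  (\int[lebesgue_measure]_(t in `]r, +oo[) f (t + c)%R =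
   \int[lebesgue_measure]_(t in `](r + c)%R, +oo[) f t)%E.
Proof.
move=> mf f0.
have mphi : measurable_fun setT (fun x : R => x + c) by exact: measurable_funD.
have -> : `]r, +oo[%classic =
    (fun x => x + c : measurableTypeR R) @^-1` `]r + c, +oo[%classic.
  by apply/seteqP; split => x /=; rewrite !in_itv/= !andbT ltrD2r.
rewrite -ge0_integral_pushforward//=.
- apply: eq_measure_integral => //= A mA AS.
  exact: lebesgue_measure_shift.
- by move=> t; rewrite inE/= in_itv/= andbT => /f0.
Qed.

(** * Measurability of the derivative and of the Lagrangian along a curve *)

(* The library has both structures on matrices, but not their join. *)
HB.instance Definition _ (R : realType) (m n : nat) := Complete.on 'M[R]_(m, n).

(** By completeness, derivability at [s] is the Cauchy criterion for the difference quotients, a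
    countable intersection of countable unions of the sets [F k m]. Each quotient is continuous in
    [s], so [F k m] is closed, even though it intersects uncountably many conditions. *)
Lemma measurable_derivable_set (R : realType) (V : completeNormedModType R)
    (g : R -> V) : continuous g ->
  measurable [set s : R | cvg (h^-1 *: (g (h + s) - g s) @[h --> 0^'])].
Proof.
move=> cg.
pose q s h := h^-1 *: (g (h + s) - g s).
pose near0 (m : nat) : set R := [set h | 0 < `|h| < m.+1%:R^-1].
pose F (k m : nat) : set R := \bigcap_(hh in near0 m `*` near0 m)
  [set s | `|q s hh.1 - q s hh.2| <= k.+1%:R^-1].
have cq h : continuous (q ^~ h).
  move=> s; apply: cvgZr; apply: cvgB; last exact: cg.
  apply: (@continuous_comp _ _ _ (fun s => h + s) g); last exact: cg.
  by apply: cvgD; [exact: cvg_cst|exact: cvg_id].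
suff -> : [set s : R | cvg (q s h @[h --> 0^'])] =
    \bigcap_k \bigcup_m F k m.
  apply: bigcap_measurable => // k _; apply: bigcup_measurable => m _.
  apply: closed_measurable; apply: closed_bigI => -[h h'] _ /=.
  apply: (@closed_comp _ _ (fun s => `|q s h - q s h'|)
    [set y | y <= k.+1%:R^-1]).
    by move=> s _; apply: cvg_norm; apply: cvgB; exact: cq.
  exact: closed_le.
apply/seteqP; split => s /=.
  move=> /cauchy_cvgP /cauchy_ballP cs k _.
  have [|[P Q] [[d /= d0 dP] [e /= e0 eQ]] PQ] := cs k.+1%:R^-1.
    by rewrite invr_gt0.
  have [m mde] : exists m : nat, m.+1%:R^-1 < Num.min d e.
    have de0 : 0 < Num.min d e by rewrite lt_min d0.
    have [m _ /(_ m (leqnn m))] := near_infty_natSinv_lt (PosNum de0).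
    by exists m.
  move: mde; rewrite lt_min => /andP[md me].
  exists m => // -[h h'] /= [] /andP[h0 hm] /andP[h'0 h'm].
  have Ph : P (q s h).
    by apply: dP; [rewrite /= sub0r normrN (lt_trans hm)|rewrite -normr_gt0].
  have Qh : Q (q s h').
    by apply: eQ; [rewrite /= sub0r normrN (lt_trans h'm)|rewrite -normr_gt0].
  have := PQ (q s h, q s h') (conj Ph Qh).
  by rewrite -ball_normE /= => /ltW.
move=> FF; apply/cauchy_cvgP/cauchy_ballP => e e0.
have [k _ /(_ k (leqnn k)) ke] := near_infty_natSinv_lt (PosNum e0).
have [m _ Fm] := FF k I.
(* The Cauchy property asks for two members of the image filter; the same set serves as both. *)
exists (q s @` near0 m, q s @` near0 m) => /=; last first.
  move=> [_ _] [/= [h nh <-] [h' nh' <-]]; rewrite -ball_normE /=.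
  by apply: le_lt_trans ke; exact: (Fm (h, h')).
have : \forall h \near (0:R)^', near0 m h.
  exists m.+1%:R^-1 => /=; first by rewrite invr_gt0.
  move=> h; rewrite /= sub0r normrN => hm h0.
  by rewrite /near0 /= normr_gt0 h0.
by move=> nr; split; apply: filterS nr => h nh; exists h.
Qed.

Lemma measurable_lagrangian_along (R : realType) (V : completeNormedModType R)
    (L : V * V -> R) (g : R -> V) : continuous L -> continuous g ->
  measurable_fun setT (fun s => L (g s, - derive1 g s)).
Proof.
move=> cL cg; set D := [set s : R | cvg (h^-1 *: (g (h + s) - g s) @[h --> 0^'])].
have mD : measurable D by exact: measurable_derivable_set.
pose hn (m : nat) : R := m.+1%:R^-1.
rewrite -(setvU D); apply/measurable_funU => //; first exact: measurableC.
split.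
  (* Off [D] the derivative takes its default value [point], so the function is continuous in [s]
     there; on [D] it is a pointwise limit of continuous functions, with increments [hn m]. *)
  apply: (eq_measurable_fun (fun s => L (g s, - point))).
    move=> s /set_mem /= Ds; congr (L (_, - _)); apply/esym/dvgP.
    by move=> h; apply: Ds.
  apply: measurable_funTS; apply: continuous_measurable_fun => s.
  apply: (@continuous_comp _ _ _ (fun s => (g s, - point)) L); last exact: cL.
  by apply: cvg_pair; [exact: cg|exact: cvg_cst].
apply: (@measurable_fun_cvg _ _ _ _
  (fun m s => L (g s, - ((hn m)^-1 *: (g (hn m + s) - g s))))).
  move=> m; apply: measurable_funTS; apply: continuous_measurable_fun => s.
  apply: (@continuous_comp _ _ _ (fun s => (g s, _)) L); last exact: cL.
  apply: cvg_pair; first exact: cg.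
  apply: cvgN; apply: cvgZr; apply: cvgB; last exact: cg.
  apply: (@continuous_comp _ _ _ (fun s => hn m + s) g); last exact: cg.
  by apply: cvgD; [exact: cvg_cst|exact: cvg_id].
move=> s Ds.
apply: (cvg_comp _ L); last exact: cL.
apply: cvg_pair; first exact: cvg_cst.
apply: cvgN.
apply: (cvg_comp hn (fun h => h^-1 *: (g (h + s) - g s)) _ Ds).
move=> P [e /= e0 eP].
have := near_infty_natSinv_lt (PosNum e0); apply: filterS => m /= me.
apply: eP; last by rewrite /hn invr_neq0 // pnatr_eq0.
by rewrite /= sub0r normrN /hn ger0_norm // invr_ge0.
Qed.

(** * Integrals of functions bounded below, and splitting of half-lines *)

(** The negative part is dominated by the absolute value of [k]; once it has a finite integral, the
    upper bound on the whole integral makes that of the positive part finite. *)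
Lemma integrable_bounded_below d (T : measurableType d) (R : realType)
    (mu : {measure set T -> \bar R}) (D : set T) (f k : T -> R) :
  measurable D -> measurable_fun D f -> mu.-integrable D (EFin \o k) ->
  (forall t, D t -> - k t <= f t) ->
  (\int[mu]_(t in D) (f t)%:E < +oo)%E -> mu.-integrable D (EFin \o f).
Proof.
move=> mD mf ik kf fy.
have mEf : measurable_fun D (EFin \o f) by exact/measurable_EFinP.
have fny : (\int[mu]_(t in D) (EFin \o f)^\- t < +oo)%E.
  have /integrableP[_] := ik; apply: le_lt_trans; apply: ge0_le_integral => //.
  - exact: measurable_funeneg.
  - by apply: measurableT_comp => //; case/integrableP: ik.
  - move=> t Dt; rewrite funenegE/= -EFin_max lee_fin ge_max normr_ge0 andbT.
    by have := kf t Dt; have := ler_norm (k t); lra.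
have fpy : (\int[mu]_(t in D) (EFin \o f)^\+ t < +oo)%E.
  have fn : (\int[mu]_(t in D) (EFin \o f)^\- t)%E \is a fin_num.
    by rewrite ge0_fin_numE// integral_ge0.
  by move: fy; rewrite integralE -(fineK fn) lteBlDr// addye.
apply/integrableP; split => //.
rewrite (eq_integral (fun t => (EFin \o f)^\+ t + (EFin \o f)^\- t)%E); last first.
  by move=> t _; exact: (congr1 (@^~ t) (fune_abse (EFin \o f))).
rewrite ge0_integralD//; first exact: lte_add_pinfty.
- exact: measurable_funepos.
- exact: measurable_funeneg.
Qed.

Lemma ge0_integral_itv_split (R : realType) (a b : R) (f : R -> R) :
  a <= b -> measurable_fun `]a, +oo[%classic f ->
  (forall t, a < t -> 0 <= f t) ->
  (\int[lebesgue_measure]_(t in `]a, +oo[) (f t)%:E =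
   \int[lebesgue_measure]_(t in `]a, b]) (f t)%:E +
   \int[lebesgue_measure]_(t in `]b, +oo[) (f t)%:E)%E.
Proof.
move=> ab mf f0; have -> : `]a, +oo[%classic = `]a, b] `|` `]b, +oo[.
  by apply: itv_bndbnd_setU; rewrite bnd_simp.
have eqU : `]a, b]%classic `|` `]b, +oo[%classic = `]a, +oo[%classic.
  by apply/esym/itv_bndbnd_setU; rewrite bnd_simp.
rewrite ge0_integral_setU//= ?eqU.
- exact/measurable_EFinP.
- move=> t [] /=; rewrite in_itv/= ?andbT lee_fin => at_; apply: f0.
    by case/andP: at_.
  exact: le_lt_trans at_.
- apply/disj_setPS => t [] /=; rewrite !in_itv/= andbT => /andP[_ tb].
  by rewrite ltNge tb.
Qed.

(** * Derivatives of the pieces of a spliced curve *)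

Lemma near_eq_derive1 (R : realType) (V : normedModType R) (f g : R -> V) (t : R) :
  (\near t, f t = g t) -> derive1 f t = derive1 g t.
Proof. by move=> fg; rewrite !derive1E; exact: near_eq_derive. Qed.

(** Both sides are limits of the same difference quotients, so their default values agree as
    well. *)
Lemma derive1_shift (R : realType) (V : normedModType R) (f : R -> V) (c t : R) :
  derive1 (fun t => f (t + c)) t = derive1 f (t + c).
Proof. by rewrite /derive1/=; under eq_fun do rewrite -addrA. Qed.

Lemma derive1_line (R : realType) (V : normedModType R) (a e : V) (s t : R) :
  derive1 (fun t => a + (t - s) *: e) t = e.
Proof.
apply: cvg_lim => //; apply: cvg_near_cst; near=> h.
rewrite opprD addrACA subrr add0r -scalerBl (_ : _ - _ = h); last by ring.
by rewrite scalerA mulVf ?scale1r//; near: h; exact: nbhs_dnbhs_neq.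
Unshelve. all: by end_near. Qed.

(** * Cost comparison for a spliced curve *)

(** Split [f] at [s] and [s + h], and [g] at [s] and [s + tau]. The heads agree, and translation
    bounds the tail of [g] by that of [f]; both parts of [f] have finite integrals and cancel. The
    pointwise hypotheses omit the joints [s] and [s + tau], where a spliced curve may have a corner;
    these are null sets. *)
Lemma integral_splice_le (R : realType) (f g : R -> R) (s h tau k : R) :
  0 <= s -> 0 <= h -> 0 <= tau ->
  lebesgue_measure.-integrable `](0:R), +oo[%classic (EFin \o f) ->
  measurable_fun `](0:R), +oo[%classic g ->
  (forall t, 0 <= f t) -> (forall t, 0 <= g t) ->
  (forall t, t < s -> g t = f t) ->
  (forall t, s < t -> t < s + tau -> g t <= k) ->
  (forall t, s + tau < t -> g t <= f (t + (h - tau))) ->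
  (\int[lebesgue_measure]_(t in `]0%R, +oo[) (f t)%:E <=
   \int[lebesgue_measure]_(t in `]0%R, +oo[) (g t)%:E)%E ->
  (\int[lebesgue_measure]_(t in `]s, (s + h)%R]) (f t)%:E <= (k * tau)%:E)%E.
Proof.
move=> s0 h0 tau0 intf mg f0 g0 gf gk gshift.
have /integrableP[/measurable_EFinP mf _] := intf.
have sub_pos a (y : itv_bound R) : 0 <= a ->
    [set` Interval (BRight a) y] `<=` `](0:R), +oo[%classic.
  by move=> a0 t /=; rewrite in_itv/= => /andP[+ _]; rewrite in_itv/= andbT; exact: le_lt_trans.
have m_itv (F : R -> R) a (y : itv_bound R) : 0 <= a ->
    measurable_fun `](0:R), +oo[%classic F ->
    measurable_fun [set` Interval (BRight a) y] (fun t => (F t)%:E).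
  by move=> a0 mF; apply/measurable_EFinP; apply: measurable_funS (sub_pos _ _ a0) mF.
have fin_itv a (y : itv_bound R) : 0 <= a ->
    (\int[lebesgue_measure]_(t in [set` Interval (BRight a) y]) (f t)%:E)%E \is a fin_num.
  move=> a0; apply: integrable_fin_num => //.
  by apply: (integrableS _ _ _ intf) => //; exact: sub_pos.
have head : (\int[lebesgue_measure]_(t in `]0%R, s]) (g t)%:E =
    \int[lebesgue_measure]_(t in `]0%R, s]) (f t)%:E)%E.
  rewrite -(integral_itv_bndo_bndc (m_itv g 0 (BLeft s) (lexx 0) mg)).
  rewrite -(integral_itv_bndo_bndc (m_itv f 0 (BLeft s) (lexx 0) mf)).
  by apply: eq_integral => t; rewrite inE/= in_itv/= => /andP[_ /gf->].
have middle : (\int[lebesgue_measure]_(t in `]s, (s + tau)%R]) (g t)%:E <=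
    (k * tau)%:E)%E.
  rewrite -(integral_itv_bndo_bndc (m_itv g s (BLeft (s + tau)) s0 mg)).
  have -> : (k * tau)%:E =
      (\int[lebesgue_measure]_(t in `]s, (s + tau)%R[) cst k%:E t)%E.
    rewrite integral_cst//= lebesgue_measure_itv/= lte_fin ltrDl.
    (* If [tau = 0] the interval is empty and both sides vanish. *)
    have [_|] := ltP 0 tau; first by rewrite -EFinB -EFinM addrAC subrr add0r.
    by move=> tau0'; rewrite (_ : tau = 0) ?mulr0 ?mule0//; lra.
  apply: ge0_le_integral => //.
  - by move=> t _; rewrite lee_fin.
  - exact: m_itv.
  - by move=> t /=; rewrite in_itv/= => /andP[st ts]; rewrite lee_fin gk.
have tail : (\int[lebesgue_measure]_(t in `](s + tau)%R, +oo[) (g t)%:E <=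
    \int[lebesgue_measure]_(t in `](s + h)%R, +oo[) (f t)%:E)%E.
  have eqsh : s + tau + (h - tau) = s + h by ring.
  have shift_pos : [set t + (h - tau) | t in `]s + tau, +oo[] `<=` `](0:R), +oo[%classic.
    by move=> _ [t /= + <-]; rewrite !in_itv/= !andbT; lra.
  rewrite -eqsh -(ge0_integral_shift _ _ _ (fun t => (f t)%:E)); last 2 first.
  - by apply: m_itv => //; lra.
  - by move=> t _; rewrite lee_fin.
  apply: ge0_le_integral => //.
  - by move=> t _; rewrite lee_fin.
  - by apply: m_itv => //; lra.
  - apply/measurable_EFinP; apply: (measurable_comp _ shift_pos mf) => //.
    exact: measurable_funD.
  - by move=> t /=; rewrite in_itv/= andbT => st; rewrite lee_fin gshift.
rewrite (ge0_integral_itv_split _ 0 s f s0 mf (fun t _ => f0 t)).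
rewrite (ge0_integral_itv_split _ 0 s g s0 mg (fun t _ => g0 t)).
rewrite head leeD2lE ?fin_itv//.
rewrite (ge0_integral_itv_split _ s (s + h) f); [|by lra| |by []]; last first.
  exact: measurable_funS (sub_pos _ _ s0) mf.
rewrite (ge0_integral_itv_split _ s (s + tau) g); [|by lra| |by []]; last first.
  exact: measurable_funS (sub_pos _ _ s0) mg.
move=> /le_trans /(_ (leeD middle tail)).
by rewrite leeD2rE// fin_itv// addr_ge0.
Qed.

(** * Lebesgue differentiation from the right *)

(** Extend [f] by 0 to an integrable function on the line and differentiate its primitive from
    [-oo]; an increment of the primitive is an integral over []s, s + h]], where the extension
    agrees with [f]. *)
Lemma ae_right_derivative_integral (R : realType) (f : R -> R) :
  lebesgue_measure.-integrable `](0:R), +oo[%classic (EFin \o f) ->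
  {ae lebesgue_measure, forall s : R, 0 < s ->
    h^-1 * \int[lebesgue_measure]_(t in `]s, s + h]) f t @[h --> 0^'+] --> f s}.
Proof.
move=> intf; set pos := `]0, +oo[%classic in intf.
pose G := f \_ pos.
have intG : lebesgue_measure.-integrable setT (EFin \o G).
  by move: intf => /integrable_mkcond -/(_ (measurable_itv _)); rewrite (restrict_EFin f).
have intGy y : lebesgue_measure.-integrable `]-oo, y] (EFin \o G).
  by apply: (integrableS _ _ _ intG).
have locG : locally_integrable setT G.
  by apply: open_integrable_locally => //; exact: openT.
have := FTC1Ny intGy locG.
apply: filterS; first exact: (ae_filter_ringOfSetsType (@lebesgue_measure R)).
move=> s /= [dF F's] s0.
set F := fun x : R => _ in dF F's.
have {F's} : h^-1 *: (F (h + s) - F s) @[h --> 0^'] --> G s.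
  rewrite -F's; move: dF; rewrite /derivable.
  by under eq_fun do rewrite /= [_ *: 1]mulr1.
have -> : G s = f s by rewrite /G patchE mem_set// /pos/= in_itv/= s0.
move=> /cvg_dnbhs_at_right; apply: cvg_trans; apply: near_eq_cvg; near=> h.
have h0 : 0 < h by near: h; exact: nbhs_right_gt.
rewrite /F (_ : `]-oo, h + s]%classic = `]-oo, s] `|` `]s, h + s]); last first.
  by apply: itv_bndbnd_setU; rewrite bnd_simp // lerDr ltW.
rewrite Rintegral_setU//=; last 2 first.
  by apply: (integrableS _ _ _ intG) => //; exact: measurableU.
  by apply/disj_setPS => t [] /=; rewrite !in_itv/= => ts /andP[]; rewrite ltNge ts.
rewrite addrAC subrr add0r addrC; congr (_ * _).
apply: eq_Rintegral => t; rewrite inE/= in_itv/= => /andP[st _].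
by rewrite /G patchE mem_set// /pos/= in_itv/= (lt_trans s0).
Unshelve. all: by end_near. Qed.

(** * Minimizers of the discounted cost *)

Section minimizer.
Context {R : realType} {n : nat}.
Variables (A B : R) (L : 'rV[R]_n -> 'rV[R]_n -> R).
Hypotheses (A0 : 0 < A) (B0 : 0 < B).
Hypothesis continuous_L : continuous (fun z : 'rV[R]_n * 'rV[R]_n => L z.1 z.2).
Hypothesis growth_L : forall y v, A^-1 * enorm v ^+ 2 - B <= L y v
                 /\ L y v <= A * enorm v ^+ 2 + B.

Local Notation mu := (@lebesgue_measure R).
Local Notation pos := (`]0%R, +oo[%classic : set R).

Let running (eta : R -> 'rV[R]_n) (t : R) : R :=
  expR (- t) * L (eta t) (- derive1 eta t).

Let shifted (eta : R -> 'rV[R]_n) (t : R) : R :=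
  expR (- t) * (L (eta t) (- derive1 eta t) + B).

Let shifted_ge0 eta t : 0 <= shifted eta t.
Proof.
apply: mulr_ge0; first exact: expR_ge0.
have [+ _] := growth_L (eta t) (- derive1 eta t).
have : 0 <= A^-1 * enorm (- derive1 eta t) ^+ 2.
  by rewrite mulr_ge0 ?invr_ge0 ?sqr_ge0// ltW.
by lra.
Qed.

(** Cutting time off at 0 gives a curve continuous on the whole line that agrees with [eta] near
    every positive time, hence has the same derivative there. *)
Let measurable_running eta : AC_halfline eta -> measurable_fun pos (running eta).
Proof.
move=> ac.
apply: (eq_measurable_fun (running (fun t => eta (Num.max t 0)))).
  move=> t; rewrite inE/= in_itv/= andbT => t0.
  rewrite /running max_l; last exact: ltW.
  congr (_ * L _ (- _)); apply: near_eq_derive1.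
  by near=> s; rewrite max_l//; apply/ltW; near: s; exact: lt_nbhsr.
apply: measurable_funTS; apply: measurable_funM.
  exact: measurableT_comp.
exact: (measurable_lagrangian_along _ _ _ _ continuous_L (AC_halfline_continuous _ ac)).
Unshelve. all: by end_near. Qed.

Let integrable_expRN : mu.-integrable pos (EFin \o (fun t => expR (- t))).
Proof.
(* On [pos] the discount is the density of the exponential law of rate 1. *)
have /integrableS := @integrable_exponential_pdf R 1 ltr01.
move=> /(_ pos measurableT (measurable_itv _) (@subsetT _ _)).
apply: eq_integrable => // t; rewrite inE/= in_itv/= andbT => t0.
by rewrite exponential_pdfE ?ltW// mul1r mulN1r.
Qed.

Let integrable_BexpRN : mu.-integrable pos (EFin \o (fun t => B * expR (- t))).
Proof.
by apply: (eq_integrable _ _ _ _ (integrableZl _ B integrable_expRN)).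
Qed.

Let runningE eta t : running eta t = shifted eta t - B * expR (- t).
Proof. by rewrite /running /shifted; ring. Qed.

Let costE eta : AC_halfline eta ->
  cost L eta = (\int[mu]_(t in pos) (running eta t)%:E)%E.
Proof.
move=> ac; rewrite [RHS]integral_itv_obnd_cbnd//.
by apply/measurable_EFinP; exact: measurable_running.
Qed.

Let measurable_shifted eta : AC_halfline eta -> measurable_fun pos (shifted eta).
Proof.
move=> ac; apply: (eq_measurable_fun (fun t => running eta t + B * expR (- t))).
  by move=> t _; rewrite runningE subrK.
apply: measurable_funD; first exact: measurable_running.
by case/integrableP: integrable_BexpRN => /measurable_EFinP.
Qed.

Let shifted_cost eta : AC_halfline eta ->
  mu.-integrable pos (EFin \o running eta) ->
  (\int[mu]_(t in pos) (shifted eta t)%:E =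
   cost L eta + \int[mu]_(t in pos) (B * expR (- t))%:E)%E.
Proof.
move=> ac ir; rewrite costE// -integralD_EFin//.
by apply: eq_integral => t _ /=; rewrite runningE -EFinD subrK.
Qed.

(** Staying at the initial point is the competitor that makes the cost of the minimizer finite. *)
Let cost_cst_lty y : (cost L (fun=> y) < +oo)%E.
Proof.
have ac : AC_halfline (fun=> y).
  by apply: AC_halfline_lipschitz => s t _ st; rewrite subrr enorm0 subr_ge0.
rewrite costE//; apply: integrable_lty => //.
apply: (eq_integrable _ _ _ _ (integrableZl _ (L y 0) integrable_expRN)) => //.
move=> t _ /=; rewrite -EFinM /running mulrC.
by rewrite -[fun=> y]/(cst y) derive1_cst oppr0.
Qed.

Variables (x : 'rV[R]_n) (eta : R -> 'rV[R]_n).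
Hypotheses (eta_adm : admissible x eta) (eta_min : cost L eta = value L x).

Let eta_ac : AC_halfline eta. Proof. by case: eta_adm. Qed.

Let cost_min zeta : admissible x zeta -> (cost L eta <= cost L zeta)%E.
Proof. by move=> adm; rewrite eta_min; apply: ereal_inf_lbound; exists zeta. Qed.

Let integrable_running : mu.-integrable pos (EFin \o running eta).
Proof.
apply: (integrable_bounded_below _ _ _ _ _ _ _ _ _ integrable_BexpRN) => //.
- exact: measurable_running.
- by move=> t _; rewrite runningE; have := shifted_ge0 eta t; lra.
- rewrite -costE//; apply: le_lt_trans (cost_cst_lty x); apply: cost_min; split => //.
  by apply: AC_halfline_lipschitz => s t _ st; rewrite subrr enorm0 subr_ge0.
Qed.

Let integrable_shifted : mu.-integrable pos (EFin \o shifted eta).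
Proof.
apply: (eq_integrable _ _ _ _ (integrableD _ integrable_running integrable_BexpRN)) => //.
by move=> t _ /=; rewrite runningE -EFinD subrK.
Qed.

(** The shift adds the same finite integral of [B * expR (- t)] to both costs. This requires
    [running zeta] to be integrable, which follows as soon as the right-hand side is finite;
    otherwise the inequality is trivial. *)
Let shifted_min zeta : admissible x zeta ->
  (\int[mu]_(t in pos) (shifted eta t)%:E <=
   \int[mu]_(t in pos) (shifted zeta t)%:E)%E.
Proof.
move=> adm; have ac : AC_halfline zeta by case: adm.
have [->|] := eqVneq (\int[mu]_(t in pos) (shifted zeta t)%:E)%E +oo%E.
  by rewrite leey.
rewrite -ltey => sy.
have is_ : mu.-integrable pos (EFin \o shifted zeta).
  apply: (integrable_bounded_below _ _ _ _ _ _ _ _ _ integrable_BexpRN) => //.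
  - exact: measurable_shifted.
  - by move=> t _; have := shifted_ge0 zeta t; have := mulr_gt0 B0 (expR_gt0 (- t)); lra.
have ir : mu.-integrable pos (EFin \o running zeta).
  apply: (eq_integrable _ _ _ _ (integrableB _ is_ integrable_BexpRN)) => //.
  by move=> t _ /=; rewrite runningE -EFinB.
rewrite (shifted_cost eta eta_ac integrable_running) (shifted_cost zeta ac ir).
by apply: leeD2r; exact: cost_min.
Qed.

Lemma minimizer_increment s h : 0 < s -> 0 < h ->
  h <= enorm (eta (s + h) - eta s) ->
  (\int[mu]_(t in `]s, (s + h)%R]) (shifted eta t)%:E <=
   (expR (- s) * (A + 2 * B) * enorm (eta (s + h) - eta s))%:E)%E.
Proof.
move=> s0 h0; set tau := enorm _ => htau.
have tau0 : 0 < tau by exact: lt_le_trans htau.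
pose e := tau^-1 *: (eta (s + h) - eta s).
have enorme : enorm e = 1.
  by rewrite enormZ gtr0_norm ?invr_gt0// mulVf// gt_eqF.
pose zeta := (eta \o (fun t => Num.min t s)) \+
  ((fun t => (Num.min (Num.max t s) (s + tau) - s) *: e) \+
   ((eta \o (fun t => Num.max t (s + tau) + (h - tau))) \+
    (fun=> - eta (s + h)))).
have zetaE t : zeta t = eta (Num.min t s) +
    ((Num.min (Num.max t s) (s + tau) - s) *: e +
     (eta (Num.max t (s + tau) + (h - tau)) - eta (s + h))) by [].
have stE : s + tau + (h - tau) = s + h by ring.
have zeta1 t : t <= s -> zeta t = eta t.
  move=> ts; have sst : s <= s + tau by lra.
  rewrite zetaE min_l// (max_r ts) (min_l sst) subrr scale0r add0r max_r; last by lra.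
  by rewrite stE subrr addr0.
have zeta2 t : s <= t -> t <= s + tau -> zeta t = eta s + (t - s) *: e.
  move=> st tst.
  by rewrite zetaE min_r// (max_l st) (min_l tst) (max_r tst) stE subrr addr0.
have zeta3 t : s + tau <= t -> zeta t = eta (t + (h - tau)).
  move=> st; have st' : s <= t by lra.
  rewrite zetaE (min_r st') (max_l st') (min_r st) (max_l st).
  have -> : s + tau - s = tau by ring.
  rewrite /e scalerA divff ?gt_eqF// scale1r addrA subrKC.
  by rewrite addrC subrK.
have adm : admissible x zeta.
  split; last by rewrite zeta1 ?ltW//; case: eta_adm.
  have mono_lip (phi : R -> R) : (forall t, 0 <= t -> 0 <= phi t) ->
      (forall t u, t <= u -> phi t <= phi u /\ phi u - phi t <= u - t) ->
      AC_halfline (eta \o phi).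
    by move=> phi0 phiP; apply: AC_halfline_comp => // t u _ /phiP[].
  apply: AC_halflineD; first apply: mono_lip.
  - by move=> t t0; rewrite le_min t0 ltW.
  - by move=> t u tu; case: (leP t s); case: (leP u s); lra.
  apply: AC_halflineD.
    apply: AC_halfline_lipschitz => t u _ tu.
    have [mtu mul] : Num.max t s <= Num.max u s /\ Num.max u s - Num.max t s <= u - t.
      by case: (leP t s); case: (leP u s); lra.
    rewrite -scalerBl enormZ enorme mulr1 ger0_norm; move: mtu mul;
      by case: (leP (Num.max t s) (s + tau)); case: (leP (Num.max u s) (s + tau)); lra.
  apply: AC_halflineD; first apply: mono_lip.
  - by move=> t t0; case: (leP t (s + tau)); lra.
  - by move=> t u tu; case: (leP t (s + tau)); case: (leP u (s + tau)); lra.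
  by apply: AC_halfline_lipschitz => t u _ tu; rewrite subrr enorm0 subr_ge0.
have ac : AC_halfline zeta by case: adm.
apply: (integral_splice_le _ (shifted eta) (shifted zeta) s h tau
  (expR (- s) * (A + 2 * B)) (ltW s0) (ltW h0) (ltW tau0) integrable_shifted
  (measurable_shifted zeta ac) (shifted_ge0 eta) (shifted_ge0 zeta) _ _ _
  (shifted_min zeta adm)).
- move=> t ts; rewrite /shifted (zeta1 t (ltW ts)).
  have -> // : derive1 zeta t = derive1 eta t.
  apply: near_eq_derive1.
  by near=> u; apply: zeta1; apply/ltW; near: u; exact: lt_nbhsl.
- move=> t st ts; rewrite /shifted.
  have -> : derive1 zeta t = e.
    rewrite -[RHS](derive1_line _ _ (eta s) e s t); apply: near_eq_derive1.
    by near=> u; apply: zeta2; apply/ltW; near: u;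
      [exact: lt_nbhsr|exact: lt_nbhsl].
  (* At unit speed [L] is at most [A + B], and the shift adds another [B]. *)
  have [Ll Lu] := growth_L (zeta t) (- e).
  rewrite enormN enorme expr1n !mulr1 in Ll Lu.
  have A1 : 0 < A^-1 by rewrite invr_gt0.
  apply: ler_pM; [exact: expR_ge0|lra| |lra].
  by rewrite ler_expR lerN2 ltW.
- move=> t st; rewrite /shifted (zeta3 t (ltW st)).
  have -> : derive1 zeta t = derive1 eta (t + (h - tau)).
    rewrite -derive1_shift; apply: near_eq_derive1.
    by near=> u; apply: zeta3; apply/ltW; near: u; exact: lt_nbhsr.
  (* Here [h <= tau] is used: [t + (h - tau) <= t], so the discount at [t] is the smaller one.
     Multiplying the discounts by [L + B] keeps their order because [L + B] is nonnegative. *)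
  have := shifted_ge0 eta (t + (h - tau)).
  rewrite /shifted pmulr_rge0 ?expR_gt0// => M0.
  by apply: ler_wpM2r => //; rewrite ler_expR; lra.
Unshelve. all: by end_near. Qed.

Lemma minimizer_speed :
  {ae mu, forall s : R, 0 < s -> enorm (derive1 eta s) <= 1 + A * (A + 2 * B)}.
Proof.
have AB0 : 0 < A + 2 * B by rewrite addr_gt0// mulr_gt0.
have C0 : 0 < A * (A + 2 * B) by exact: mulr_gt0.
suff main (s : R) : 0 < s ->
    h^-1 * \int[mu]_(t in `]s, s + h]) shifted eta t @[h --> 0^'+]
      --> shifted eta s ->
    enorm (derive1 eta s) <= 1 + A * (A + 2 * B).
  have := ae_right_derivative_integral _ _ integrable_shifted.
  apply: filterS; first exact: (ae_filter_ringOfSetsType (@lebesgue_measure R)).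
  by move=> s ds s0; apply: main (ds s0).
move=> s0 ds.
(* The summand 1 of the bound covers speeds up to 1; any other speed forces [h <= tau] for small
   [h]. *)
have [v1|v1] := leP (enorm (derive1 eta s)) 1; first by lra.
pose q h := h^-1 *: (eta (h + s) - eta s).
have qv : q h @[h --> 0^'] --> derive1 eta s.
  (* Without a limit, [derive1] would be the default [point], the zero vector, against [v1]. *)
  have [//|qN] := pselect (cvg (q h @[h --> 0^'])).
  have v0 : derive1 eta s = 0.
    have -> : derive1 eta s = point by exact: dvgP.
    by apply/rowP => i; rewrite !mxE.
  by move: v1; rewrite v0 enorm0; lra.
have enq : enorm (q h) @[h --> 0^'+] --> enorm (derive1 eta s).
  apply: (cvg_comp q enorm _ (continuous_enorm _)).
  exact: cvg_dnbhs_at_right.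
have : shifted eta s <= expR (- s) * (A + 2 * B) * enorm (derive1 eta s).
  apply: (ler_cvg_to ds (cvgM (cvg_cst (expR (- s) * (A + 2 * B))) enq)).
  near=> h.
  have h0 : 0 < h by near: h; exact: nbhs_right_gt.
  (* The quotients inherit the strict bound of their limit, which is the condition [h <= tau] of
     [minimizer_increment]. *)
  have enq1 : 1 < enorm (q h) by near: h; exact: (cvgr_gt _ enq).
  have enqE : enorm (eta (s + h) - eta s) = h * enorm (q h).
    rewrite /q enormZ gtr0_norm ?invr_gt0// mulrA divff ?gt_eqF// mul1r.
    by rewrite (addrC h).
  have hle : h <= enorm (eta (s + h) - eta s).
    by rewrite enqE ler_peMr// ltW.
  have := minimizer_increment s h s0 h0 hle; rewrite enqE.
  have fin : (\int[mu]_(t in `]s, (s + h)%R]) (shifted eta t)%:E)%E \is a fin_num.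
    apply: integrable_fin_num => //; apply: (integrableS _ _ _ integrable_shifted) => //.
    move=> t /=; rewrite !in_itv/= andbT => /andP[+ _]; exact: lt_trans.
  rewrite -(fineK fin) lee_fin => incr.
  by rewrite mulrC ler_pdivrMr// -mulrA (mulrC _ h).
rewrite /shifted -mulrA ler_pM2l ?expR_gt0//.
have [+ _] := growth_L (eta s) (- derive1 eta s); rewrite enormN => Ll Lu.
have : A^-1 * enorm (derive1 eta s) ^+ 2 <= (A + 2 * B) * enorm (derive1 eta s).
  by lra.
(* One factor of the speed cancels, being larger than 1. *)
rewrite expr2 mulrA ler_pM2r; last by lra.
by rewrite ler_pdivrMl//; lra.
Unshelve. all: by end_near. Qed.

End minimizer.

Theorem lemma5p9 (R : realType) (C_H A B : R)
    (hC_H : 0 < C_H) (hA : 0 < A) (hB : 0 < B) :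
  exists2 C5 : R, 0 < C5 &
    forall (n : nat) (H : 'rV[R]_n -> 'rV[R]_n -> R)
      (x : 'rV[R]_n) (eta : R -> 'rV[R]_n),
    (0 < n)%N ->
    hamiltonian H ->
    (W1oo_norm (value (lagrangian H)) <= C_H%:E)%E ->
    (forall y v, A^-1 * enorm v ^+ 2 - B <= lagrangian H y v
                 /\ lagrangian H y v <= A * enorm v ^+ 2 + B) ->
    continuously_differentiable
      (fun z : 'rV[R]_n * 'rV[R]_n => lagrangian H z.1 z.2 : R^o) ->
    admissible x eta ->
    cost (lagrangian H) eta = value (lagrangian H) x ->
    {ae lebesgue_measure, forall s : R, 0 < s -> enorm (derive1 eta s) <= C5}.
Proof.
exists (1 + A * (A + 2 * B)).
  by rewrite addr_gt0// mulr_gt0// addr_gt0// mulr_gt0.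
move=> n H x eta _ _ _ growth [diffL _] adm min.
apply: (minimizer_speed A B (lagrangian H) hA hB _ growth x eta adm min) => z.
exact: differentiable_continuous (diffL z).
Qed.
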